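(* Let $\boldsymbol\eta=(\eta_t)_{t\in[0,1]}$ be a standard max-stable process. Let $\mathcal G_d=\{s_0^{(d)},\dots,s_d^{(d)}\}$, $0=s_0^{(d)}<\dots<s_d^{(d)}=1$, $d\in\mathbb{N}$, be grids in $[0,1]$ with diameter $\kappa_d:=\max_{i=1,\dots,d}(s_i^{(d)}-s_{i-1}^{(d)})\to0$ as $d\to\infty$, and let $\hat{\boldsymbol\eta}^{(d)}=(\hat\eta^{(d)}_t)_{t\in[0,1]}$ be the discretized version of $\boldsymbol\eta$ with grid $\mathcal G_d$. For $t\in[0,1]$ and $d\in\mathbb{N}$ let $\|\cdot\|_{D_t^{(d)}}$ be the $D$-norm pertaining to the (standard max-stable) random vector $(\eta_t,\hat\eta_t^{(d)})$. Then for every $t\in[0,1]$ the mean squared error of $\hat\eta_t^{(d)}$ is given by $$\operatorname{MSE}\bigl(\hat\eta_t^{(d)}\bigr):=E\Bigl(\bigl(\eta_t-\hat\eta_t^{(d)}\bigr)^2\Bigr)=2\left(2-\int_0^\infty\frac{1}{\|(1,u)\|^2_{D_t^{(d)}}}\,du\right)\to_{d\to\infty}0.$$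
   Context: $\bar C^+[0,1]$ and $\bar C^-[0,1]$ are the nonnegative and nonpositive functions in $C[0,1]$; $\bar E^-[0,1]$ is the set of bounded nonpositive functions $f:[0,1]\to\mathbb{R}$ with only finitely many discontinuities. Standard max-stable process (SMSP): a max-stable process $\boldsymbol\eta=(\eta_t)_{t\in[0,1]}$ with sample paths in $\bar C^-[0,1]$ and margins $P(\eta_t\le x)=e^x$, $x\le0$. Equivalently, there is a process $\boldsymbol Z=(Z_t)_{t\in[0,1]}$ with sample paths in $\bar C^+[0,1]$, $Z_t\le c$ a.s. for some constant $c\ge1$, and $E(Z_t)=1$ for all $t$ (a generator process), such that $P(\boldsymbol\eta\le f)=\exp(-E(\sup_{t\in[0,1]}|f(t)|Z_t))$ for all $f\in\bar E^-[0,1]$. The $D$-norm pertaining to a standard max-stable random vector $(X,Y)$ is the norm $\|\cdot\|_D$ on $\mathbb{R}^2$ of the form $\|(x,y)\|_D=E(\max(|x|Z_1,|y|Z_2))$, with $0\le Z_i\le c$ a.s. for some constant $c\ge 1$ and $E(Z_i)=1$, satisfying $P(X\le x,Y\le y)=\exp(-\|(x,y)\|_D)$ for $x,y\le0$. Discretized version: for a grid $0=s_0<s_1<\dots<s_d=1$ let $\|(x,y)\|_{D_{i-1,i}}=E(\max(|x|Z_{s_{i-1}},|y|Z_{s_i}))$ be the $D$-norm pertaining to $(\eta_{s_{i-1}},\eta_{s_i})$. The discretized version of $\boldsymbol\eta$ with this grid is $$\hat\eta_t=\|(s_i-t,t-s_{i-1})\|_{D_{i-1,i}}\max\left(\frac{\eta_{s_{i-1}}}{s_i-t},\frac{\eta_{s_i}}{t-s_{i-1}}\right),\quad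 t\in[s_{i-1},s_i],\ i=1,\dots,d.$$ For every $t$ the vector $(\eta_t,\hat\eta_t)$ is standard max-stable; for $t\in[s_{i-1},s_i]$ its $D$-norm is generated by $(Z_t,\hat Z_t)$ with $\hat Z_t=\max((s_i-t)Z_{s_{i-1}},(t-s_{i-1})Z_{s_i})/\|(s_i-t,t-s_{i-1})\|_{D_{i-1,i}}$. Convention: $\eta_{s_i}<0$ a.s., and $x/0:=-\infty$ for $x<0$. *)

(* Defs.v *)
From HB Require Import structures.
From mathcomp Require Import all_boot all_order all_algebra.
From mathcomp Require Import all_classical all_reals all_analysis.
Set Implicit Arguments.
Unset Strict Implicit.
Unset Printing Implicit Defensive.
Import Order.TTheory GRing.Theory Num.Theory.
Import numFieldNormedType.Exports.
Local Open Scope classical_set_scope.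
Local Open Scope ring_scope.

(* A process on [0,1] is a family indexed by all of R; only the indices in
   [0,1] are ever constrained or used. *)

Definition cont01 {R : realType} (f : R -> R) : Prop :=
  {within `[0, 1], continuous f}.

(* The event that X_t lies in B t for all t in the finite list s; such
   cylinders with measurable B t generate the sigma-algebra of the process. *)
Definition cylinder {R : realType} {T : Type} (X : R -> T -> R)
    (s : seq R) (B : R -> set R) : set T :=
  [set w | forall t, t \in s -> B t (X t w)].

Definition eq_law {R : realType} {d d' : measure_display}
    {T : measurableType d} {T' : measurableType d'}
    (P : probability T R) (Q : probability T' R)
    (X : R -> T -> R) (Y : R -> T' -> R) : Prop :=
  forall (s : seq R) (B : R -> set R),
    {subset s <= `[0, 1]} -> (forall t, measurable (B t)) ->
    P (cylinder X s B) = Q (cylinder Y s B).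

Definition indep_processes {R : realType} {d : measure_display}
    {T : measurableType d} (P : probability T R) (n : nat)
    (X : 'I_n -> R -> T -> R) : Prop :=
  forall (s : seq R) (B : 'I_n -> R -> set R),
    {subset s <= `[0, 1]} -> (forall i t, measurable (B i t)) ->
    P (\bigcap_i cylinder (X i) s (B i)) =
    (\prod_(i < n) P (cylinder (X i) s (B i)))%E.

(* For each n there are continuous a > 0 and b such that
   max_i (X_i - b) / a has the law of eta, for n + 1 i.i.d. copies X_i. *)
Definition max_stable {R : realType} {d : measure_display}
    {T : measurableType d} (P : probability T R)
    (eta : R -> {RV P >-> R}) : Prop :=
  forall n : nat, exists a b : R -> R,
    [/\ cont01 a, cont01 b, (forall t, t \in `[0, 1] -> 0 < a t) &
      forall (d' : measure_display) (T' : measurableType d')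
        (Q : probability T' R) (X : 'I_n.+1 -> R -> {RV Q >-> R}),
        indep_processes Q (fun i t => X i t : T' -> R) ->
        (forall i, eq_law Q P (fun t => X i t : T' -> R)
                              (fun t => eta t : T -> R)) ->
        eq_law Q P
          (fun t w => (\big[Num.max/X ord0 t w]_(i < n.+1) X i t w - b t) / a t)
          (fun t => eta t : T -> R)].

Definition generator {R : realType} {d : measure_display}
    {T : measurableType d} (Q : probability T R)
    (Z : R -> {RV Q >-> R}) : Prop :=
  [/\ forall w, cont01 (fun t => Z t w),
      forall w t, t \in `[0, 1] -> 0 <= Z t w,
      exists2 c : R, 1 <= c &
        forall t, t \in `[0, 1] -> {ae Q, forall w, Z t w <= c} &
      forall t, t \in `[0, 1] -> ('E_Q[Z t])%E = 1%:E].

(* The set \bar E^-[0,1]. *)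
Definition Eminus {R : realType} (f : R -> R) : Prop :=
  [/\ [bounded f t | t in (`[0, 1] : set R)],
      forall t, t \in `[0, 1] -> f t <= 0 &
      finite_set [set t : R | t \in `[0, 1] /\
                              ~ (f @ within `[0, 1] (nbhs t) --> f t)]].

Definition generated_by {R : realType} {d d' : measure_display}
    {T : measurableType d} {T' : measurableType d'}
    (P : probability T R) (Q : probability T' R)
    (eta : R -> {RV P >-> R}) (Z : R -> {RV Q >-> R}) : Prop :=
  forall f : R -> R, Eminus f ->
    P [set w | forall t, t \in `[0, 1] -> eta t w <= f t] =
    expeR (- 'E_Q[fun w => (sup [set `|f t| * Z t w | t in `[0, 1]])%R])%E.

(* For processes with continuous nonpositive paths and standard negative
   exponential margins, max-stability and the existence of a generator are
   equivalent (Gine, Hahn and Vatan 1990); both descriptions are recorded. *)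
Definition standard_max_stable {R : realType} {d : measure_display}
    {T : measurableType d} (P : probability T R)
    (eta : R -> {RV P >-> R}) : Prop :=
  [/\ (forall w, cont01 (fun t => eta t w)) /\
      (forall w t, t \in `[0, 1] -> eta t w <= 0),
      forall t x, t \in `[0, 1] -> x <= 0 ->
        P [set w | eta t w <= x] = (expR x)%:E,
      max_stable eta &
      exists (d' : measure_display) (T' : measurableType d')
        (Q : probability T' R) (Z : R -> {RV Q >-> R}),
        generator Z /\ generated_by eta Z].

Definition pertains {R : realType} {d : measure_display}
    {T : measurableType d} (P : probability T R) (X Y : T -> R)
    (N : R * R -> R) : Prop :=
  (exists (d' : measure_display) (T' : measurableType d')
      (Q : probability T' R) (Z1 Z2 : {RV Q >-> R}),
    [/\ exists2 c : R, 1 <= c &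
          {ae Q, forall w, 0 <= Z1 w <= c /\ 0 <= Z2 w <= c},
        ('E_Q[Z1])%E = 1%:E, ('E_Q[Z2])%E = 1%:E &
        forall x y : R, (N (x, y))%:E =
          ('E_Q[fun w => Num.max (`|x| * Z1 w)%R (`|y| * Z2 w)%R])%E]) /\
  (forall x y : R, x <= 0 -> y <= 0 ->
    P [set w | X w <= x /\ Y w <= y] = (expR (- N (x, y)))%:E).

Lemma pertains_unique {R : realType} {d : measure_display}
    {T : measurableType d} (P : probability T R) (X Y : T -> R)
    (N N' : R * R -> R) :
  pertains P X Y N -> pertains P X Y N' -> N = N'.
Proof.
have even M : pertains P X Y M ->
    forall x y : R, M (x, y) = M (- `|x|, - `|y|).
  case=> -[d' [T' [Q [Z1 [Z2 [_ _ _ ME]]]]]] _ x y.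
  by apply/EFin_inj; rewrite !ME !normrN !normr_id.
move=> HN HN'; apply/funext => -[x y].
rewrite (even _ HN) (even _ HN'); case: HN => _ HN; case: HN' => _ HN'.
apply/oppr_inj/expR_inj/EFin_inj.
by rewrite -HN ?oppr_le0// -HN' ?oppr_le0.
Qed.

(* The D-norm pertaining to (X, Y); unique by the preceding lemma, and equal
   to 0 when (X, Y) is not standard max-stable. *)
Definition Dnorm {R : realType} {d : measure_display}
    {T : measurableType d} (P : probability T R) (X Y : T -> R) : R * R -> R :=
  xget (fun=> 0) [set N | pertains P X Y N].

Definition is_grid {R : realType} (d : nat) (s : nat -> R) : Prop :=
  [/\ s 0%N = 0, s d = 1 & forall i, (i < d)%N -> s i < s i.+1].

Definition diameter {R : realType} (d : nat) (s : nat -> R) : R :=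
  \big[Num.max/0]_(i < d) (s i.+1 - s i).

(* At an inner grid point both adjacent cells yield the same value of the
   discretized version almost surely; the left one is selected. *)
Definition cell {R : realType} (d : nat) (s : nat -> R) (t : R) : nat :=
  find (fun j => t <= s j.+1) (iota 0 d).

Lemma cellP {R : realType} (d : nat) (s : nat -> R) (t : R) :
  (0 < d)%N -> is_grid d s -> t \in `[0, 1] ->
  (cell d s t < d)%N /\ s (cell d s t) <= t <= s (cell d s t).+1.
Proof.
move=> d0 [s0 sd _]; rewrite in_itv/= => /andP[t0 t1].
have H : has (fun j => t <= s j.+1) (iota 0 d).
  by apply/hasP; exists d.-1; rewrite ?mem_iota ?add0n /= prednK // sd.
have := nth_find 0%N H; move: (H); rewrite has_find size_iota -/(cell d s t).
move=> cd; rewrite nth_iota // add0n => ->; split=> //; rewrite andbT.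
case E: (cell d s t) => [|j]; first by rewrite s0.
have : (j < find (fun j => (t <= s j.+1)%R) (iota 0 d))%N.
  by rewrite -/(cell d s t) E.
move=> /(before_find 0%N); rewrite nth_iota ?add0n.
  by move/negbT; rewrite -ltNge => /ltW.
by apply: leq_trans cd; rewrite E.
Qed.

(* The quotients are taken in \bar R, where 0^-1 = +oo, so that x / 0 = -oo
   for x < 0; the two denominators never vanish simultaneously. *)
Definition discretized {R : realType} {d : measure_display}
    {T : measurableType d} (P : probability T R)
    (eta : R -> {RV P >-> R}) (n : nat) (s : nat -> R) (t : R) (w : T) : R :=
  let a := s (cell n s t) in
  let b := s (cell n s t).+1 in
  fine ((Dnorm P (eta a) (eta b) (b - t, t - a))%:E *
        maxe ((eta a w)%:E / (b - t)%:E) ((eta b w)%:E / (t - a)%:E))%E.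

(* Main.v *)
(* For nonpositive X and Y with standard exponential tails whose joint lower
   tail at (-x, -xu) is exp(-x g(u)), writing Y = int_0^oo x 1{x u <= -Y} du for
   x > 0 and using Tonelli gives
   E(XY) = int_0^oo int_0^oo x exp(-x g(u)) dx du = int_0^oo g(u)^-2 du.
   With X = Y and g(u) = max(1, u) this is E(X^2) = 2, and the formula for the
   mean squared error follows by expanding the square.

   The joint law of (eta_t, eta_a, eta_b) for a cell [a, b] containing t comes
   from step functions in the generator formula; it shows that
   (Z_t, max(al Z_a, be Z_b) / N) generates (eta_t, hat eta_t), where
   al = b - t, be = t - a and N = ||(al, be)||_D >= max(al, be). Hence, with
   e = E|Z_a - Z_t| + E|Z_b - Z_t|,
   max(1, u) <= ||(1, u)|| <= (1 + e) max(1, u),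
   so the mean squared error is at most 4 (1 - (1 + e)^-2) <= 8 e, and e -> 0 by
   path continuity and dominated convergence. *)
Require Import Defs.
From mathcomp Require Import all_boot all_order all_algebra.
From mathcomp Require Import all_classical all_reals all_analysis.
From mathcomp Require Import measurable_realfun ring lra.
Import Order.TTheory GRing.Theory Num.Theory.
Import numFieldNormedType.Exports.
Local Open Scope classical_set_scope.
Local Open Scope ring_scope.

(** * Two explicit integrals over the half-line *)

Lemma integral_mul_expR {R : realType} (l : R) : 0 < l ->
  (\int[lebesgue_measure]_(x in `[0%R, +oo[) (x * expR (- (x * l)))%:E =
   ((l ^+ 2)^-1)%:E)%E.
Proof.
move=> l0; have lN0 : l != 0 by rewrite gt_eqF.
(* An antiderivative obtained by parts; the value [(l ^+ 2)^-1] is [- F 0], as [F] vanishes at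
   infinity. *)
pose F (x : R) := - (x / l + (l ^+ 2)^-1) * expR (- (x * l)).
have dF (x : R) : is_derive x 1 F (x * expR (- (x * l))).
  by apply: is_derive_eq; rewrite /GRing.scale/=; field.
have cF : continuous F.
  by move=> x; apply/differentiable_continuous/derivable1_diffP.
rewrite (@ge0_continuous_FTC2y _ _ F _ 0).
- rewrite /F !mul0r oppr0 expR0 add0r mulr1.
  by rewrite add0r -EFinN opprK.
- by move=> x x0; rewrite mulr_ge0// expR_ge0.
- apply: continuous_subspaceT => x.
  apply/differentiable_continuous/derivable1_diffP.
  exact: (ex_derive (f := fun x : R => x * expR (- (x * l)))).
- have hl : l / 2 * x @[x --> +oo] --> +oo.
    by apply: gt0_cvgMry => //; rewrite divr_gt0.
  (* Half of the exponential absorbs the linear factor: $x/l + l^{-2} = (2/l^2)(1/2 + lx/2) \le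
     (2/l^2) e^{lx/2}$, so this function dominates [- F]. *)
  have : 2 / l ^+ 2 * expR (- (l / 2 * x)) @[x --> +oo] --> (0 : R).
    rewrite -[X in _ --> X](mulr0 (2 / l ^+ 2)).
    apply: cvgM; first exact: cvg_cst.
    exact: (cvg_comp _ _ hl (@cvgr_expR R)).
  move=> h; apply: (squeeze_cvgr (h := cst 0)
    (f := fun x => - (2 / l ^+ 2 * expR (- (l / 2 * x))))).
  + near=> x; apply/andP; split.
      rewrite /F mulNr lerN2.
      have -> : expR (- (x * l)) = expR (- (l / 2 * x)) * expR (- (l / 2 * x)).
        by rewrite -expRD; congr expR; field.
      rewrite mulrA ler_wpM2r ?expR_ge0//.
      rewrite expRN ler_pdivrMr ?expR_gt0//.
      have -> : x / l + (l ^+ 2)^-1 = 2 / l ^+ 2 * (2^-1 + l / 2 * x) by field.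
      rewrite ler_wpM2l ?divr_ge0 ?exprn_ge0 ?ltW//.
      have := expR_ge1Dx (l / 2 * x); lra.
    rewrite /F mulNr oppr_le0 mulr_ge0 ?expR_ge0// addr_ge0//.
      by rewrite divr_ge0// ltW.
    by rewrite invr_ge0 exprn_ge0// ltW.
  + by rewrite -[X in _ --> X]oppr0; apply: cvgN.
  + exact: cvg_cst.
- by move=> x _; apply: ex_derive.
- exact/cvg_at_right_filter/cF.
- by move=> x _; rewrite derive1E; apply: derive_val.
Unshelve. all: by end_near.
Qed.

(** The intervals $[0,1]$ and $]1,\infty[$ contribute 1 each. This is the value of the tail integral
    in the case of two equal variables. *)
Lemma integral_inv_max_sq (R : realType) :
  (\int[lebesgue_measure]_(u in `[0%R, +oo[) ((Num.max 1 u ^+ 2)^-1)%:E =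
   (2%:E : \bar R))%E.
Proof.
have mf : measurable_fun setT (fun u : R => ((Num.max 1 u ^+ 2)^-1)).
  apply: continuous_measurable_fun => u.
  have m0 : Num.max 1 u != 0 by rewrite gt_eqF// lt_max ltr01.
  apply: cvgV; first by rewrite expf_neq0.
  apply: (@continuous_comp _ R R _ (fun x => x ^+ 2)); last exact: exprn_continuous.
  by apply: (@continuous_max _ R); [exact: cst_continuous|exact: cvg_id].
have -> : `[0%R, +oo[%classic = `[0%R, 1] `|` `]1, +oo[ :> set R.
  by apply/seteqP; split => x /=; rewrite !in_itv/=; lra.
rewrite ge0_integral_setU//=; last 3 first.
- by apply/measurable_EFinP; exact: measurable_funTS.
- by move=> x _; rewrite lee_fin invr_ge0 sqr_ge0.
- by rewrite disj_set2E; apply/eqP/seteqP; split => x //=; rewrite !in_itv/=; lra.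
rewrite (_ : \int[lebesgue_measure]_(x in `[(0:R)%R, 1%R]) _ = 1)%E; last first.
  rewrite (eq_integral (cst 1%E)).
    by rewrite integral_cst//= lebesgue_measure_itv/= lte_fin ltr01 sube0 mul1e.
  move=> x; rewrite inE/= in_itv/= => /andP[x0 x1].
  by rewrite max_l// expr1n invr1.
rewrite (integral_itv_obnd_cbnd (r := 1)); last first.
  by apply/measurable_EFinP; exact: measurable_funTS.
pose F (u : R) := - u^-1.
rewrite [X in (_ + X)%E](_ : _ =
    (\int[lebesgue_measure]_(x in `[1%R, +oo[) (x ^- 2)%:E)%E); last first.
  by apply: eq_integral => x; rewrite inE/= in_itv/= andbT => x1; rewrite max_r.
have dF (y : R) : 0 < y -> is_derive y 1 F (y ^- 2).
  move=> y0; have ? : y != 0 by rewrite gt_eqF.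
  apply: is_derive_eq; first by apply: is_deriveN; exact: is_deriveV.
  by rewrite /GRing.scale/= mulr1 opprK.
rewrite (@ge0_continuous_FTC2y _ _ F _ 0).
- by rewrite /F invr1 add0e -EFinN opprK -EFinD.
- by move=> x x1; rewrite invr_ge0 sqr_ge0.
- apply: continuous_in_subspaceT => x; rewrite inE/= in_itv/= andbT => x1.
  apply: cvgV; last exact: exprn_continuous.
  by rewrite expf_neq0// gt_eqF//; lra.
- rewrite -[X in _ --> X]oppr0; apply: cvgN.
  apply/gtr0_cvgV0; last exact: cvg_id.
  by near=> x.
- by move=> x x1; apply: ex_derive; apply: dF; lra.
- apply/cvg_at_right_filter.
  have ? := dF 1 ltr01.
  by apply/differentiable_continuous/derivable1_diffP.
- move=> x; rewrite in_itv/= => x1; rewrite derive1E.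
  by apply: derive_val; apply: dF; move: x1; lra.
Unshelve. all: by end_near.
Qed.

(** * Second moments from joint lower tails *)

Lemma measurable_le_setI {R : realType} {d : measure_display}
    {T : measurableType d} (f g : T -> R) (u v : R) :
  measurable_fun setT f -> measurable_fun setT g ->
  measurable [set w | f w <= u /\ g w <= v].
Proof.
move=> mf mg.
rewrite (_ : [set w | _] = (setT `&` [set w | f w <= u]) `&`
  (setT `&` [set w | g w <= v])); last by rewrite !setTI.
by apply: measurableI; apply: measurable_fun_le.
Qed.

Lemma expectation_mul_tail {R : realType} {d : measure_display}
    {T : measurableType d} (P : probability T R) (X Y : T -> R) (g : R -> R) :
  measurable_fun setT X -> measurable_fun setT Y ->
  (forall w, X w <= 0) -> (forall w, Y w <= 0) ->
  (forall u, 0 <= u -> 0 < g u) ->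
  (forall x u, 0 <= x -> 0 <= u ->
    P [set w | X w <= - x /\ Y w <= - (x * u)] = (expR (- (x * g u)))%:E) ->
  (\int[P]_w (X w * Y w)%:E =
   \int[lebesgue_measure]_(u in `[0%R, +oo[) ((g u ^+ 2)^-1)%:E)%E.
Proof.
move=> mX mY X0 Y0 g0 tail.
pose mu : {sigma_finite_measure set _ -> \bar R} := @lebesgue_measure R.
(* The domain of integration as one boolean condition, so that all integrals run over whole spaces.
   The value [x = 0] is left out because the length of the [u]-section is [- Y w / x]; it returns
   later as a null set. *)
pose b w x u := ((0 < x) && (0 <= u)) && ((X w <= - x) && (Y w <= - (x * u))).
pose G w x u : \bar R := (if b w x u then x else 0)%:E.
have G0 w x u : (0 <= G w x u)%E.
  by rewrite lee_fin /b; case: ifP => // /andP[/andP[/ltW]].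
(* Measurability under arbitrary substitutions covers the different product spaces of the three
   exchanges below. *)
have mG d' (S : measurableType d') (w : S -> T) (x u : S -> R) :
    measurable_fun setT w -> measurable_fun setT x -> measurable_fun setT u ->
    measurable_fun setT (fun z => G (w z) (x z) (u z)).
  move=> mw mx mu'; apply/measurable_EFinP.
  apply: measurable_fun_ifT => //.
  apply: measurable_and; apply: measurable_and.
  - exact: measurable_fun_ltr.
  - exact: measurable_fun_ler.
  - apply: measurable_fun_ler; first exact: measurableT_comp.
    exact: measurable_funN.
  - apply: measurable_fun_ler; first exact: measurableT_comp.
    by apply: measurable_funN; exact: measurable_funM.
have lint c D : measurable D -> (\int[mu]_x (cst c \_ D) x = c * mu D)%E.
  by move=> mD; rewrite -integral_mkcond integral_cst.
transitivity (\int[P]_w \int[mu]_x \int[mu]_u G w x u)%E.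
  apply: eq_integral => w _.
  transitivity (\int[mu]_x (cst (- Y w)%:E \_ `]0%R, (- X w)%R]) x)%E.
    rewrite lint// [mu _]lebesgue_measure_itv/= lte_fin.
    case: ltP => [_|]; first by rewrite sube0 -EFinM mulrNN mulrC.
    rewrite oppr_le0 => XX.
    by rewrite (_ : X w = 0) ?mul0r ?mule0//; apply/eqP; rewrite eq_le X0.
  apply: eq_integral => x _; rewrite patchE /G /b/=.
  case: ifPn; rewrite ?inE ?notin_setE/= in_itv/=.
    move=> /andP[x0 xX].
    transitivity (\int[mu]_u (cst x%:E \_ `[0%R, (- Y w / x)%R]) u)%E.
      rewrite lint// [mu _]lebesgue_measure_itv/= lte_fin.
      case: ltP => [_|]; first by rewrite sube0 -EFinM mulrC divfK// gt_eqF.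
      rewrite ler_pdivrMr// mul0r oppr_le0 => YY.
      by rewrite (_ : Y w = 0) ?oppr0 ?mule0//; apply/eqP; rewrite eq_le Y0.
    apply: eq_integral => u _; rewrite patchE x0 lerNr xX/=.
    rewrite mem_setE in_itv/= ler_pdivlMr// lerNr mulrC.
    by case: (_ && _).
  move=> /negP xX; apply/esym; rewrite integral0_eq// => u _.
  by case: ifP => // /andP[/andP[x0 _] /andP[xX' _]]; rewrite x0 lerNr xX' in xX.
(* Three Tonelli exchanges make the integral over [u] outermost and the one over [w] innermost,
   where it yields [x] times a joint tail. *)
transitivity (\int[P]_w \int[mu]_u \int[mu]_x G w x u)%E.
  apply: eq_integral => w _.
  apply: (fubini_tonelli (m1 := mu) (m2 := mu) (fun z => G w z.1 z.2)) => //.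
  exact: mG.
transitivity (\int[mu]_u \int[P]_w \int[mu]_x G w x u)%E.
  apply: (fubini_tonelli (m1 := P) (m2 := mu)
    (fun z => (\int[mu]_x G z.1 x z.2)%E)); last first.
    by move=> z; apply: integral_ge0.
  apply: (measurable_fun_fubini_tonelli_F (m2 := mu)
    (fun z : (T * measurableTypeR R) * measurableTypeR R => G z.1.1 z.2 z.1.2)) => //.
  by apply: mG => //; exact: measurableT_comp.
transitivity (\int[mu]_u \int[mu]_x \int[P]_w G w x u)%E.
  apply: eq_integral => u _.
  apply: (fubini_tonelli (m1 := P) (m2 := mu) (fun z => G z.1 z.2 u)) => //.
  exact: mG.
rewrite [RHS]integral_mkcond; apply: eq_integral => u _.
rewrite patchE mem_setE in_itv/= andbT; case: ifPn => u0; last first.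
  rewrite integral0_eq// => x _; rewrite integral0_eq// => w _.
  by rewrite /G /b (negbTE u0) andbF.
rewrite -(integral_mul_expR _ (g0 u u0)) -integral_itv_obnd_cbnd; last first.
  apply/measurable_EFinP; apply: measurable_funTS.
  apply: measurable_funM => //; apply: measurableT_comp => //.
  by apply: measurable_funN; exact: measurable_funM.
rewrite [RHS]integral_mkcond; apply: eq_integral => x _.
rewrite patchE mem_setE in_itv/= andbT; case: ifPn => x0; last first.
  by rewrite integral0_eq// => w _; rewrite /G /b (negbTE x0).
transitivity
  (\int[P]_(w in [set w | X w <= - x /\ Y w <= - (x * u)]%R) cst x%:E w)%E; last first.
  rewrite integral_cst; first by rewrite EFinM -(tail x u (ltW x0) u0).
  exact: measurable_le_setI.
rewrite [RHS]integral_mkcond; apply: eq_integral => w _.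
rewrite patchE /G /b x0 u0/= (_ : (w \in _) = (X w <= - x) && (Y w <= - (x * u))).
  by case: ifP.
by apply/idP/idP; rewrite inE => /andP.
Qed.

(** The product formula with both variables equal to [X]: the two constraints merge into $X \le
    -x\max(1,u)$. *)
Lemma expectation_sq_tail {R : realType} {d : measure_display}
    {T : measurableType d} (P : probability T R) (X : T -> R) :
  measurable_fun setT X -> (forall w, X w <= 0) ->
  (forall x, 0 <= x -> P [set w | X w <= - x] = (expR (- x))%:E) ->
  (\int[P]_w (X w * X w)%:E = 2%:E)%E.
Proof.
move=> mX X0 tail; rewrite -integral_inv_max_sq.
apply: expectation_mul_tail => // [u _|x u x0 u0]; first by rewrite lt_max ltr01.
rewrite -tail; last by rewrite mulr_ge0// le_max ler01.
congr (P _); apply/seteqP; rewrite maxr_pMr// mulr1.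
by split => w /=; rewrite [X w <= - Num.max _ _]lerNr ge_max ![_ <= - X w]lerNr => /andP.
Qed.

Lemma mean_sq_diff_tail {R : realType} {d : measure_display}
    {T : measurableType d} (P : probability T R) (X Y : T -> R) (g : R -> R) :
  measurable_fun setT X -> measurable_fun setT Y ->
  (forall w, X w <= 0) -> (forall w, Y w <= 0) ->
  (forall x, 0 <= x -> P [set w | X w <= - x] = (expR (- x))%:E) ->
  (forall x, 0 <= x -> P [set w | Y w <= - x] = (expR (- x))%:E) ->
  (forall u, 0 <= u -> 0 < g u) ->
  (forall x u, 0 <= x -> 0 <= u ->
    P [set w | X w <= - x /\ Y w <= - (x * u)] = (expR (- (x * g u)))%:E) ->
  (\int[P]_w ((X w - Y w) ^+ 2)%:E = 2%:E * (2%:E -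
   \int[lebesgue_measure]_(u in `[0%R, +oo[) ((g u ^+ 2)^-1)%:E))%E.
Proof.
move=> mX mY X0 Y0 tX tY g0 tXY.
rewrite -(expectation_mul_tail _ _ _ _ mX mY X0 Y0 g0 tXY).
have mXY : measurable_fun setT (fun w => (X w * Y w)%:E).
  by apply/measurable_EFinP; exact: measurable_funM.
have XY0 w : (0 <= (X w * Y w)%:E)%E by rewrite lee_fin mulr_le0.
(* The square is expanded additively, so that only nonnegative functions are integrated. The finite
   total $4 = 2 + 2$ then excludes infinite terms and makes the subtraction legitimate. *)
have key : (\int[P]_w ((X w - Y w) ^+ 2)%:E +
    2%:E * \int[P]_w (X w * Y w)%:E = 4%:E)%E.
  rewrite -ge0_integralZl//=.
  rewrite -ge0_integralD//=.
  - under eq_integral do rewrite -EFinM -EFinD.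
    transitivity (\int[P]_w ((X w * X w)%:E + (Y w * Y w)%:E))%E.
      by apply: eq_integral => w _; rewrite -EFinD; congr EFin; ring.
    rewrite ge0_integralD//=.
    + by rewrite !expectation_sq_tail// -EFinD; congr EFin; ring.
    + by move=> w _; rewrite lee_fin mulr_le0.
    + by apply/measurable_EFinP; exact: measurable_funM.
    + by move=> w _; rewrite lee_fin mulr_le0.
    + by apply/measurable_EFinP; exact: measurable_funM.
  - by move=> w _; rewrite lee_fin sqr_ge0.
  - apply/measurable_EFinP; apply: measurable_funX.
    exact: measurable_funB.
  - by move=> w _; rewrite mule_ge0// lee_fin.
  - exact: measurable_funeM.
have A0 : (0 <= \int[P]_w ((X w - Y w) ^+ 2)%:E)%E.
  by apply: integral_ge0 => w _; rewrite lee_fin sqr_ge0.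
have B0 : (0 <= \int[P]_w (X w * Y w)%:E)%E by apply: integral_ge0.
move: key A0 B0.
case: (\int[P]_w ((X w - Y w) ^+ 2)%:E)%E => [a| |];
  case: (\int[P]_w (X w * Y w)%:E)%E => [b| |] //=.
- rewrite -EFinM -EFinD => -[ab] _ _; rewrite -EFinB -EFinM; congr EFin; lra.
- by rewrite mulry gtr0_sg// mul1e.
- by rewrite mulry gtr0_sg// mul1e.
Qed.

(** * Finite-dimensional distributions and $D$-norms from a generator *)

(** The generator formula is applied to a function vanishing off the finitely many listed points.
    There it imposes no constraint, since [eta] is nonpositive, and adds nothing to the supremum,
    which becomes a finite maximum. *)
Lemma generated_by_fidi {R : realType} {d d' : measure_display}
    {T : measurableType d} {T' : measurableType d'}
    (P : probability T R) (Q : probability T' R)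
    (eta : R -> {RV P >-> R}) (Z : R -> {RV Q >-> R}) (s : seq (R * R)) :
  (forall w t, t \in `[0, 1] -> eta t w <= 0) -> generator Z ->
  generated_by eta Z -> (forall p, p \in s -> p.1 \in `[0, 1]) ->
  P [set w | forall p, p \in s -> eta p.1 w <= - p.2] =
  expeR (- 'E_Q[fun w => (\big[Num.max/0]_(p <- s) (p.2 * Z p.1 w))%R])%E.
Proof.
move=> eta0 [_ Z0 _ _] etaZ s01.
(* A point may be listed several times, and its largest level is the binding one. The default 0
   serves unlisted points and negative levels, whose constraints hold trivially. *)
pose F t := \big[Num.max/0]_(p <- s | p.1 == t) p.2.
have F0 t : 0 <= F t by apply: bigmax_ge_id.
have FE t : `|- F t| = F t by rewrite normrN ger0_norm.
have Fp p : p \in s -> p.2 <= F p.1 by move=> ps; apply: le_bigmax_seq.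
have Fout t : t \notin map fst s -> F t = 0.
  move=> ts; rewrite /F big_hasC//.
  by apply: contra ts => /hasP[p ps /eqP <-]; exact: map_f.
have FM t : F t <= \sum_(p <- s) `|p.2|.
  have S0 : 0 <= \sum_(p <- s) `|p.2| by apply: sumr_ge0.
  rewrite /F big_seq_cond; apply: bigmax_le => // p /andP[ps _].
  rewrite (le_trans (ler_norm _))// (perm_big _ (perm_to_rem ps)) big_cons.
  by rewrite lerDl sumr_ge0.
have EF : Eminus (fun t => - F t).
  split.
  - exists (\sum_(p <- s) `|p.2|); split; first exact: num_real.
    by move=> x xM t _ /=; rewrite FE (le_trans (FM t))// ltW.
  - by move=> t _; rewrite oppr_le0.
  - apply: (sub_finite_set _ (finite_seq (map fst s))) => t /= -[_ tF].
    apply: contrapT => /negP ts; apply: tF; apply: cvg_within_filter.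
    rewrite Fout// oppr0; apply: cvg_near_cst.
    (* The listed points form a closed set, so [F] is constantly 0 near any other point and only
       listed points can be discontinuities. *)
    have : nbhs t (~` [set` map fst s]).
      apply: open_nbhs_nbhs; split; last exact/negP.
      apply: closed_openC; move: (finite_seq (map fst s)).
      apply: (iffLR accessible_finite_set_closed).
      exact/hausdorff_accessible/Rhausdorff.
    apply: filterS => u /negP us /=; by rewrite Fout// oppr0.
have := etaZ _ EF; rewrite (_ : [set w | _] =
    [set w | forall p, p \in s -> eta p.1 w <= - p.2]); last first.
  apply/seteqP; split => w /= etaw.
    move=> p ps; rewrite (le_trans (etaw _ (s01 _ ps)))// lerN2; exact: Fp.
  move=> t t01; rewrite lerNr /F big_seq_cond.
  apply: bigmax_le; first by rewrite oppr_ge0 eta0.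
  by move=> p /andP[ps /eqP <-]; rewrite lerNr etaw.
move=> ->; congr (expeR (- 'E_Q[_])%E); apply/funext => w.
have ub : ubound [set `|- F t| * Z t w | t in `[0, 1]]
    (\big[Num.max/0]_(p <- s) (p.2 * Z p.1 w)).
  move=> _ [t /= t01 <-]; rewrite FE /F.
  rewrite (big_morph (fun x => x * Z t w) (id1 := 0) (op1 := Num.max)); last 2 first.
  - by move=> x y; rewrite maxr_pMl// Z0.
  - by rewrite mul0r.
  rewrite big_seq_cond; apply: bigmax_le => [|p /andP[ps /eqP <-]].
    by apply: bigmax_ge_id.
  by apply: (le_bigmax_seq 0 p xpredT (fun p => p.2 * Z p.1 w)).
apply/eqP; rewrite eq_le; apply/andP; split.
  apply: ge_sup => //; exists (`|- F 0| * Z 0 w).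
  by exists 0 => //=; rewrite in_itv/= lexx ler01.
have supub t : t \in `[0, 1] ->
    F t * Z t w <= sup [set `|- F t| * Z t w | t in `[0, 1]].
  by move=> t01; apply: ub_le_sup; [eexists; exact: ub|exists t => //; rewrite FE].
rewrite big_seq; apply: bigmax_le => [|p ps].
  have z01 : (0 : R) \in `[0, 1] by rewrite in_itv/= lexx ler01.
  by rewrite (le_trans _ (supub _ z01))// mulr_ge0// Z0.
by rewrite (le_trans _ (supub _ (s01 _ ps)))// ler_wpM2r ?Z0 ?s01// Fp.
Qed.

Lemma expectationE {R : realType} {d : measure_display}
    {T : measurableType d} (P : probability T R) (X : T -> R) :
  'E_P[X]%E = (\int[P]_w (X w)%:E)%E.
Proof. by rewrite unlock. Qed.

(** A maximum of nonnegative terms dominates each of them and is at most their sum. This gives both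
    finiteness and positivity of the $D$-norms below. *)
Lemma expectation_max_bounds {R : realType} {d : measure_display}
    {T : measurableType d} (Q : probability T R) (Z1 Z2 : {RV Q >-> R}) (x y : R) :
  (forall w, 0 <= Z1 w) -> (forall w, 0 <= Z2 w) ->
  'E_Q[Z1]%E = 1%:E -> 'E_Q[Z2]%E = 1%:E ->
  ((Num.max `|x| `|y|)%:E <=
     'E_Q[fun w => Num.max (`|x| * Z1 w)%R (`|y| * Z2 w)%R] <=
   (`|x| + `|y|)%:E)%E.
Proof.
move=> Z10 Z20 E1 E2.
have mZ (Z : {RV Q >-> R}) (u : R) : measurable_fun setT (fun w => (`|u| * Z w)%:E).
  by apply/measurable_EFinP; exact: measurable_funM.
have mM : measurable_fun setT (fun w => (Num.max (`|x| * Z1 w) (`|y| * Z2 w))%:E).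
  by apply/measurable_EFinP; apply: measurable_maxr; exact: measurable_funM.
have EZ (Z : {RV Q >-> R}) (u : R) : (forall w, 0 <= Z w) -> 'E_Q[Z]%E = 1%:E ->
    (\int[Q]_w (`|u| * Z w)%:E)%E = `|u|%:E.
  move=> Z0; rewrite expectationE => EZ; under eq_integral do rewrite EFinM.
  rewrite ge0_integralZl//.
  - by rewrite EZ mule1.
  - by apply/measurable_EFinP.
  - by move=> w _; rewrite lee_fin.
rewrite expectationE; apply/andP; split.
  rewrite EFin_max ge_max.
  apply/andP; split; [rewrite -(EZ Z1)//|rewrite -(EZ Z2)//]; apply: ge0_le_integral => //.
  - by move=> w _; rewrite lee_fin mulr_ge0.
  - by move=> w _; rewrite lee_fin le_max lexx.
  - by move=> w _; rewrite lee_fin mulr_ge0.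
  - by move=> w _; rewrite lee_fin le_max lexx orbT.
apply: (@le_trans _ _ (\int[Q]_w ((`|x| * Z1 w)%:E + (`|y| * Z2 w)%:E))%E).
  apply: ge0_le_integral => //.
  - by move=> w _; rewrite lee_fin le_max mulr_ge0.
  - by apply: emeasurable_funD.
  - by move=> w _; rewrite -EFinD lee_fin ge_max lerDl lerDr !mulr_ge0.
rewrite ge0_integralD//.
- by rewrite !EZ// -EFinD.
- by move=> w _; rewrite lee_fin mulr_ge0.
- by move=> w _; rewrite lee_fin mulr_ge0.
Qed.

(** [Dnorm] is defined by choice: exhibiting one norm that pertains to the pair shows that the
    chosen one does, and uniqueness transfers the formula to it. *)
Lemma Dnorm_generated {R : realType} {d d' : measure_display}
    {T : measurableType d} {T' : measurableType d'}
    (P : probability T R) (Q : probability T' R) (X Y : T -> R)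
    (Z1 Z2 : {RV Q >-> R}) (c : R) :
  1 <= c -> {ae Q, forall w, 0 <= Z1 w <= c /\ 0 <= Z2 w <= c} ->
  (forall w, 0 <= Z1 w) -> (forall w, 0 <= Z2 w) ->
  'E_Q[Z1]%E = 1%:E -> 'E_Q[Z2]%E = 1%:E ->
  (forall x y : R, 0 <= x -> 0 <= y ->
    P [set w | X w <= - x /\ Y w <= - y] =
    expeR (- 'E_Q[fun w => Num.max (x * Z1 w)%R (y * Z2 w)%R])%E) ->
  pertains P X Y (Dnorm P X Y) /\
  forall x y : R, (Dnorm P X Y (x, y))%:E =
    ('E_Q[fun w => Num.max (`|x| * Z1 w)%R (`|y| * Z2 w)%R])%E.
Proof.
move=> c1 Zc Z10 Z20 E1 E2 PXY.
pose M (x y : R) w := Num.max (`|x| * Z1 w) (`|y| * Z2 w).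
have Mfin x y : ('E_Q[M x y])%E = (fine ('E_Q[M x y])%E)%:E.
  have /andP[lo hi] := expectation_max_bounds Q Z1 Z2 x y Z10 Z20 E1 E2.
  rewrite fineK// ge0_fin_numE; first by rewrite (le_lt_trans hi) ?ltry.
  by apply: le_trans lo; rewrite lee_fin le_max normr_ge0.
have pert : pertains P X Y (fun p => fine ('E_Q[M p.1 p.2])%E).
  split.
    exists d', T', Q, Z1, Z2; split => //; first by exists c.
    by move=> x y; rewrite -Mfin.
  move=> x y x0 y0; have := PXY (- x) (- y).
  rewrite !oppr_ge0 !opprK => /(_ x0 y0) ->.
  rewrite (_ : (fun w => _) = M x y); last first.
    by apply/funext => w; rewrite /M !ler0_norm.
  by rewrite Mfin.
have pertD : pertains P X Y (Dnorm P X Y).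
  apply: (@xgetPex _ (fun=> 0) [set N | pertains P X Y N]).
  by exists (fun p => fine (('E_Q[M p.1 p.2])%E)).
by split => // x y; rewrite (pertains_unique pertD pert)/= -Mfin.
Qed.

Lemma expectation_maxM {R : realType} {d : measure_display}
    {T : measurableType d} (Q : probability T R) (Z1 Z2 : {RV Q >-> R}) (r x y : R) :
  (forall w, 0 <= Z1 w) -> (forall w, 0 <= Z2 w) ->
  ('E_Q[fun w => Num.max (`|r * x| * Z1 w)%R (`|r * y| * Z2 w)%R] =
   `|r|%:E * 'E_Q[fun w => Num.max (`|x| * Z1 w)%R (`|y| * Z2 w)%R])%E.
Proof.
move=> Z10 Z20; rewrite !expectationE -ge0_integralZl//.
- by apply: eq_integral => w _; rewrite -EFinM maxr_pMr// !normrM !mulrA.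
- by apply/measurable_EFinP; apply: measurable_maxr; exact: measurable_funM.
- by move=> w _; rewrite lee_fin le_max mulr_ge0.
Qed.

(** For every $e > 0$, $P(X \ge 0) \le 1 - P(X \le -e) = 1 - \exp(-e) \le e$. Strict negativity is
    what the convention $x/0 = -\infty$ presupposes. *)
Lemma ae_neg_tail {R : realType} {d : measure_display}
    {T : measurableType d} (P : probability T R) (X : {RV P >-> R}) :
  (forall x, x <= 0 -> P [set w | X w <= x] = (expR x)%:E) ->
  {ae P, forall w, X w < 0}.
Proof.
move=> tail.
have mX : measurable [set w | 0 <= X w].
  by rewrite -[X in measurable X]setTI; apply: measurable_fun_le.
exists [set w | 0 <= X w]; split => //; last by move=> w /= /negP; rewrite -leNgt.
apply/eqP; rewrite eq_le measure_ge0 andbT.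
apply/lee_addgt0Pr => e e0; rewrite add0e.
have mXe : measurable [set w | X w <= - e].
  by rewrite -[X in measurable X]setTI; apply: measurable_fun_le.
apply: (@le_trans _ _ (P (~` [set w | X w <= - e]))).
  apply: le_measure; rewrite ?inE//; first exact: measurableC.
  by move=> w /= X0; apply/negP; rewrite -ltNge (lt_le_trans _ X0)// oppr_lt0.
have me0 : - e <= 0 by rewrite oppr_le0 ltW.
rewrite probability_setC// tail// -EFinB lee_fin.
by have := expR_ge1Dx (- e); lra.
Qed.

Lemma eq_probability_ae {R : realType} {d : measure_display}
    {T : measurableType d} (P : probability T R) (A B : set T) :
  measurable A -> measurable B -> {ae P, forall w, A w <-> B w} -> P A = P B.
Proof.
move=> mA mB AB; rewrite -(setIT A) -(setIT B) -!integral_indic//.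
apply: ae_eq_integral => //.
- by apply/measurable_EFinP; exact: measurable_indic.
- by apply/measurable_EFinP; exact: measurable_indic.
apply: filterS AB => w AB _; congr EFin; rewrite !indicE; congr (nat_of_bool _)%:R.
by apply/idP/idP; rewrite !inE => /AB.
Qed.

Lemma measurable_inv_sq {R : realType} {d : measure_display}
    {T : measurableType d} (g : T -> R) :
  measurable_fun setT g -> (forall u, 0 < g u) ->
  measurable_fun setT (fun u => (g u ^+ 2)^-1).
Proof.
move=> mg g0; rewrite (_ : (fun _ => _) = fun u => expR (- (ln (g u) + ln (g u)))).
  apply: measurableT_comp; first exact: measurable_expR.
  by apply: measurable_funN; apply: measurable_funD;
    apply: measurableT_comp => //; exact: measurable_ln.
by apply/funext => u; rewrite expRN expRD !lnK ?posrE.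
Qed.

(* In \bar R, p / 0 = -oo for p < 0, so al = 0 or be = 0 imposes no constraint
   on the corresponding coordinate. *)
Lemma mule_max_div_le {R : realType} (N al be p q y : R) :
  0 < N -> 0 <= al -> 0 <= be -> 0 < al + be -> p < 0 -> q < 0 -> 0 <= y ->
  fine (N%:E * maxe (p%:E / al%:E) (q%:E / be%:E))%E <= - y <->
  p <= - (y / N * al) /\ q <= - (y / N * be).
Proof.
move=> N0 al0 be0 ab0 p0 q0 y0.
have key (r c : R) : 0 < c -> (N * (r / c) <= - y) = (r <= - (y / N * c)).
  move=> c0; rewrite mulrC -ler_pdivlMr// ler_pdivrMr//.
  by rewrite -!mulNr.
have pos (c : R) : 0 < c -> (c%:E^-1)%E = c^-1%:E.
  by move=> c0; rewrite inver gt_eqF.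
have [/eqP al00|alN0] := boolP (al == 0).
  have be1 : 0 < be by rewrite al00 add0r in ab0.
  rewrite al00 inve0 lt0_muley ?lte_fin// max_r ?leNye// pos// -!EFinM/= key//.
  by rewrite mulr0 oppr0; split => [|[]//]; split=> //; exact: ltW.
have al1 : 0 < al by rewrite lt_def alN0.
have [/eqP be00|beN0] := boolP (be == 0).
  rewrite be00 inve0 (@lt0_muley _ q%:E) ?lte_fin// max_l ?leNye// pos// -!EFinM/= key//.
  by rewrite mulr0 oppr0; split => [|[]//]; split=> //; exact: ltW.
have be1 : 0 < be by rewrite lt_def beN0.
rewrite !pos// -!EFinM -EFin_max -EFinM/= maxr_pMr ?(ltW N0)// ge_max !key//.
by split => /andP.
Qed.

(** * The discretized version on a single cell *)

Section discretized_cell.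
Context {R : realType} {d d' : measure_display}
  {T : measurableType d} {T' : measurableType d'}
  (P : probability T R) (Q : probability T' R)
  (eta : R -> {RV P >-> R}) (Z : R -> {RV Q >-> R}).
Hypothesis eta0 : forall w t, t \in `[0, 1] -> eta t w <= 0.
Hypothesis tail : forall t x, t \in `[0, 1] -> x <= 0 ->
  P [set w | eta t w <= x] = (expR x)%:E.
Hypothesis genZ : generator Z.
Hypothesis etaZ : generated_by eta Z.

Lemma Dnorm_generator a b : a \in `[0, 1] -> b \in `[0, 1] ->
  forall x y : R, (Dnorm P (eta a) (eta b) (x, y))%:E =
    ('E_Q[fun w => Num.max (`|x| * Z a w)%R (`|y| * Z b w)%R])%E.
Proof.
move=> a01 b01; have [_ Z0 [c c1 Zc] EZ] := genZ.
apply: (Dnorm_generated P Q (eta a) (eta b) (Z a) (Z b) c c1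
  _ _ _ (EZ _ a01) (EZ _ b01) _).2.
- apply: filterS2 (Zc _ a01) (Zc _ b01) => w -> ->.
  by rewrite !Z0.
- by move=> w; exact: Z0.
- by move=> w; exact: Z0.
move=> x y x0 y0.
have := generated_by_fidi P Q eta Z [:: (a, x); (b, y)] eta0 genZ etaZ.
rewrite (_ : [set w | _] = [set w | eta a w <= - x /\ eta b w <= - y]).
  move=> ->.
    congr (expeR (- 'E_Q[_])%E); apply/funext => w.
    by rewrite !big_cons big_nil/= (max_l (y := 0)) ?mulr_ge0 ?Z0.
  by move=> p; rewrite !inE => /orP[]/eqP->.
apply/seteqP; split => w /= => [h|[h1 h2] p].
  by split; [apply: (h (a, x))|apply: (h (b, y))]; rewrite !inE eqxx ?orbT.
by rewrite !inE => /orP[]/eqP->.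
Qed.

Variables a b t : R.
Hypotheses (a01 : a \in `[0, 1]) (b01 : b \in `[0, 1]) (t01 : t \in `[0, 1]).
Hypotheses (at_ : a <= t) (tb : t <= b) (ab : a < b).

Let al := b - t.
Let be := t - a.
Let N := Dnorm P (eta a) (eta b) (al, be).
Let hat w := fine (N%:E * maxe ((eta a w)%:E / al%:E) ((eta b w)%:E / be%:E))%E.

Let al0 : 0 <= al. Proof. by rewrite subr_ge0. Qed.
Let be0 : 0 <= be. Proof. by rewrite subr_ge0. Qed.
Let albe0 : 0 < Num.max al be.
Proof.
rewrite lt_max /al /be !subr_gt0.
by case: (ltP t b) => //= ?; apply: lt_le_trans ab _.
Qed.

Let NE : N%:E = ('E_Q[fun w => Num.max (al * Z a w)%R (be * Z b w)%R])%E.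
Proof. by rewrite /N Dnorm_generator// !ger0_norm. Qed.

(** Besides making [N] positive, this bound lets the division by [N] cancel the weights [al] and
    [be] in every upper estimate of [hatZ]. *)
Lemma Dnorm_cell_ge : Num.max al be <= N.
Proof.
have [_ Z0 _ EZ] := genZ.
have := expectation_max_bounds Q (Z a) (Z b) al be.
rewrite !ger0_norm// -NE => /(_ _ _ (EZ _ a01) (EZ _ b01)) h.
by have /andP[] : (((Num.max al be)%:E <= N%:E <= (al + be)%:E)%E);
  [apply: h => w; exact: Z0|rewrite lee_fin].
Qed.

Let N0 : 0 < N. Proof. exact: lt_le_trans Dnorm_cell_ge. Qed.

Lemma measurable_discretized_cell : measurable_fun setT hat.
Proof.
apply: measurableT_comp; first exact: fine_measurable.
apply: emeasurable_funM => //; apply: measurable_maxe.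
- by apply: emeasurable_funM => //; apply/measurable_EFinP.
- by apply: emeasurable_funM => //; apply/measurable_EFinP.
Qed.

Lemma discretized_cell_le0 w : hat w <= 0.
Proof.
apply: fine_le0; apply: mule_ge0_le0; first by rewrite lee_fin ltW.
rewrite ge_max; apply/andP; split; apply: mule_le0_ge0;
  by rewrite ?inve_ge0 ?lee_fin ?eta0.
Qed.

Definition hatZ_fun w := Num.max (al * Z a w) (be * Z b w) / N.

Lemma measurable_hatZ : hatZ_fun \in (mfun : pred (T' -> R)).
Proof.
apply/mem_set => /=; apply: measurable_funM => //.
by apply: measurable_maxr; exact: measurable_funM.
Qed.

Definition hatZ : {RV Q >-> R} := mfun_Sub measurable_hatZ.

Lemma hatZE w : hatZ w = hatZ_fun w. Proof. by []. Qed.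

Lemma hatZ_ge0 w : 0 <= hatZ w.
Proof.
have [_ Z0 _ _] := genZ.
by rewrite hatZE divr_ge0 ?(ltW N0)// le_max mulr_ge0// Z0.
Qed.

Lemma expectation_hatZ : 'E_Q[hatZ]%E = 1%:E.
Proof.
have [_ Z0 _ _] := genZ.
rewrite expectationE.
under eq_integral do rewrite hatZE /hatZ_fun mulrC EFinM.
rewrite ge0_integralZl//.
- by rewrite -expectationE -NE -EFinM mulVf// gt_eqF.
- apply/measurable_EFinP; apply: measurable_maxr; exact: measurable_funM.
- by move=> w _; rewrite lee_fin le_max mulr_ge0// Z0.
- by rewrite lee_fin invr_ge0 ltW.
Qed.

(** Almost surely, [hat w <= - y] amounts to one threshold for [eta a] and one for [eta b], so the
    event concerns [eta] at three points only. These may coincide when [t] is an end of the cell. *)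
Lemma discretized_cell_tail x y : 0 <= x -> 0 <= y ->
  P [set w | eta t w <= - x /\ hat w <= - y] =
  expeR (- 'E_Q[fun w => Num.max (x * Z t w)%R (y * hatZ w)%R])%E.
Proof.
move=> x0 y0; have [_ Z0 _ _] := genZ.
pose s := [:: (t, x); (a, y / N * al); (b, y / N * be)].
transitivity (P [set w | forall p, p \in s -> eta p.1 w <= - p.2]).
  have sE : [set w | forall p, p \in s -> eta p.1 w <= - p.2] =
      [set w | eta t w <= - x /\ eta a w <= - (y / N * al)] `&`
      (setT `&` [set w | eta b w <= - (y / N * be)]).
    rewrite setTI; apply/seteqP; split => w /= => [h|[[h1 h2] h3] p].
      split; [split; [apply: (h (t, x))|apply: (h (a, y / N * al))]
             |apply: (h (b, y / N * be))];
      by rewrite !inE eqxx ?orbT.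
    by rewrite !inE => /or3P[]/eqP->.
  apply: eq_probability_ae.
  - by apply: measurable_le_setI => //; exact: measurable_discretized_cell.
  - rewrite sE; apply: measurableI; first exact: measurable_le_setI.
    exact: measurable_fun_le.
  have neg u : u \in `[0, 1] -> {ae P, forall w, eta u w < 0}.
    by move=> u01; apply: ae_neg_tail => z; exact: tail.
  apply: filterS2 (neg _ a01) (neg _ b01) => w na nb.
  have ab0 : 0 < al + be by rewrite /al /be addrA subrK subr_gt0.
  have e := mule_max_div_le N al be (eta a w) (eta b w) y N0 al0 be0 ab0 na nb y0.
  split=> [[h1 /e[h2 h3]] p|h].
    by rewrite !inE => /or3P[]/eqP->.
  split; first by apply: (h (t, x)); rewrite !inE eqxx.
  by apply/e; split; [apply: (h (a, y / N * al))|apply: (h (b, y / N * be))];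
    rewrite !inE eqxx ?orbT.
rewrite (generated_by_fidi P Q eta Z _ eta0 genZ etaZ); last first.
  by move=> p; rewrite !inE => /or3P[]/eqP->.
congr (expeR (- 'E_Q[_])%E); apply/funext => w.
rewrite !big_cons big_nil/= (max_l (y := 0)); last first.
  by rewrite !mulr_ge0 ?Z0 ?invr_ge0// ltW.
have yN0 : 0 <= y / N by rewrite divr_ge0// ltW.
rewrite (_ : y * (Num.max (al * Z a w) (be * Z b w) / N) =
  y / N * Num.max (al * Z a w) (be * Z b w)).
  by rewrite maxr_pMr// !(mulrA (y / N)).
by rewrite mulrA mulrAC.
Qed.


Let D := Dnorm P (eta t) hat.

Lemma Dnorm_discretized_cell : pertains P (eta t) hat D /\
  forall x y : R, (D (x, y))%:E =
    'E_Q[fun w => Num.max (`|x| * Z t w)%R (`|y| * hatZ w)%R]%E.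
Proof.
have [_ Z0 [c c1 Zc] EZ] := genZ.
apply: (Dnorm_generated P Q (eta t) hat (Z t) hatZ c c1 _ _ hatZ_ge0
  (EZ _ t01) expectation_hatZ discretized_cell_tail).
- apply: filterS3 (Zc _ a01) (Zc _ b01) (Zc _ t01) => w Za Zb Zt.
  split; apply/andP; split=> //; [exact: Z0|exact: hatZ_ge0|].
  have c0 : 0 <= c by rewrite (le_trans _ c1).
  rewrite hatZE /hatZ_fun ler_pdivrMr// [c * N]mulrC.
  (* $\max(al\,Z_a, be\,Z_b) \le c\max(al,be) \le cN$, so [hatZ] inherits the bound [c] of [Z]. *)
  apply: le_trans (ler_wpM2r c0 Dnorm_cell_ge).
  by rewrite maxr_pMl// ge_max !le_max !ler_wpM2l ?orbT.
- by move=> w; exact: Z0.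
Qed.

Let D_ge (x y : R) : Num.max `|x| `|y| <= D (x, y).
Proof.
have [_ Z0 _ EZ] := genZ; rewrite -lee_fin Dnorm_discretized_cell.2.
have := expectation_max_bounds Q (Z t) hatZ x y _ hatZ_ge0 (EZ _ t01) expectation_hatZ.
by move=> /(_ (fun w => Z0 w t t01)) /andP[].
Qed.

(** The lower and upper bounds of the norm coincide on the axis; this encodes the standard
    exponential margin of [hat]. *)
Let D0 (y : R) : D (0, y) = `|y|.
Proof.
apply/eqP; rewrite eq_le; apply/andP; split; last first.
  by apply: le_trans (D_ge 0 y); rewrite le_max lexx orbT.
have [_ Z0 _ EZ] := genZ; rewrite -lee_fin Dnorm_discretized_cell.2.
have := expectation_max_bounds Q (Z t) hatZ 0 y _ hatZ_ge0 (EZ _ t01) expectation_hatZ.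
by move=> /(_ (fun w => Z0 w t t01)) /andP[_]; rewrite [X in (X + _)%R]normr0 add0r.
Qed.

Let DM (r x y : R) : D (r * x, r * y) = `|r| * D (x, y).
Proof.
have [_ Z0 _ EZ] := genZ; apply: EFin_inj.
rewrite EFinM !Dnorm_discretized_cell.2.
by apply: expectation_maxM hatZ_ge0 => w; exact: Z0.
Qed.

Lemma mse_discretized_cell :
  (\int[P]_w ((eta t w - hat w) ^+ 2)%:E = 2%:E * (2%:E -
   \int[lebesgue_measure]_(u in `[0%R, +oo[) ((D (1, u) ^+ 2)^-1)%:E))%E.
Proof.
have [[_ Dtail] _] := Dnorm_discretized_cell.
apply: mean_sq_diff_tail.
- by [].
- exact: measurable_discretized_cell.
- by move=> w; exact: eta0.
- exact: discretized_cell_le0.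
- by move=> x x0; rewrite tail// oppr_le0.
(* The marginal tail of [hat] is the joint tail with threshold 0 for [eta t], a constraint that
   always holds. *)
- move=> x x0; rewrite -[X in expR (- X)](ger0_norm x0) -normrN -D0.
  rewrite -Dtail ?oppr_le0//; congr (P _); apply/seteqP.
  by split => w /= => [|[]//]; split => //; exact: eta0.
- by move=> u u0; apply: lt_le_trans (D_ge 1 u); rewrite lt_max normr1 ltr01.
- move=> x u x0 u0; rewrite Dtail ?oppr_le0 ?mulr_ge0//; congr (expR (- _))%:E.
  by rewrite -{1}[x]mulr1 -!mulNr DM normrN ger0_norm.
Qed.

(** Let [de] be the sum of the two increments at [w]. Both $Z_a$ and $Z_b$ are at most $Z_t + de$,
    hence so is [hatZ], and $\max(Z_t, u\,\hat Z_t) \le \max(1,u)(Z_t + de)$. Taking expectations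
    with $E(Z_t) = 1$ gives the claim. *)
Lemma Dnorm_discretized_cell_le (e u : R) : 0 <= u ->
  (\int[Q]_w `|Z a w - Z t w|%:E + \int[Q]_w `|Z b w - Z t w|%:E <= e%:E)%E ->
  D (1, u) <= (1 + e) * Num.max 1 u.
Proof.
move=> u0 he; have [_ Z0 _ EZ] := genZ.
have m0 : 0 <= Num.max 1 u by rewrite le_max ler01.
have mab c : measurable_fun setT (fun w => `|Z c w - Z t w|%:E).
  by apply/measurable_EFinP; apply: measurableT_comp => //; exact: measurable_funB.
rewrite -lee_fin Dnorm_discretized_cell.2 expectationE normr1 (ger0_norm u0).
apply: (@le_trans _ _ (\int[Q]_w ((Num.max 1 u)%:E *
  ((Z t w)%:E + (`|Z a w - Z t w|%:E + `|Z b w - Z t w|%:E))))%E).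
  apply: ge0_le_integral => //.
  - by move=> w _; rewrite lee_fin le_max mul1r Z0.
  - apply/measurable_EFinP; apply: measurable_maxr; exact: measurable_funM.
  - apply: measurable_funeM; apply: emeasurable_funD.
      by apply/measurable_EFinP.
    exact: emeasurable_funD.
  move=> w _; rewrite -!EFinD -EFinM lee_fin mul1r.
  set de := `|_| + `|_|.
  have de0 : 0 <= de by rewrite addr_ge0.
  have hZ : hatZ w <= Z t w + de.
    rewrite hatZE /hatZ_fun ler_pdivrMr// [_ * N]mulrC.
    have Zd0 : 0 <= Z t w + de by rewrite addr_ge0// Z0.
    apply: le_trans (ler_wpM2r Zd0 Dnorm_cell_ge).
    rewrite maxr_pMl// ge_max !le_max; apply/andP; split; apply/orP; [left|right];
      rewrite ler_wpM2l// -lerBlDl (le_trans (ler_norm _))// /de.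
      by rewrite lerDl.
    by rewrite lerDr.
  rewrite ge_max; apply/andP; split.
    apply: (@le_trans _ _ (1 * (Z t w + de))); first by rewrite mul1r lerDl.
    by rewrite ler_wpM2r ?addr_ge0 ?Z0// le_max lexx.
  apply: (@le_trans _ _ (u * (Z t w + de))); first by rewrite ler_wpM2l.
  by rewrite ler_wpM2r ?addr_ge0 ?Z0// le_max lexx orbT.
rewrite ge0_integralZl//; last 2 first.
- by apply: emeasurable_funD; [apply/measurable_EFinP|exact: emeasurable_funD].
- by move=> w _; rewrite -!EFinD lee_fin !addr_ge0 ?Z0.
rewrite [X in (_ <= X)%E]EFinM muleC; apply: lee_wpmul2r; first by rewrite lee_fin.
rewrite ge0_integralD//; last 4 first.
- by move=> w _; rewrite lee_fin Z0.
- by apply/measurable_EFinP.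
- by move=> w _; rewrite -EFinD lee_fin addr_ge0.
- exact: emeasurable_funD.
rewrite -expectationE (EZ _ t01) [X in (_ <= X)%E]EFinD leeD2l//.
by rewrite ge0_integralD.
Qed.

Lemma mse_discretized_cell_le :
  (\int[P]_w ((eta t w - hat w) ^+ 2)%:E <= 8%:E *
   (\int[Q]_w `|Z a w - Z t w|%:E + \int[Q]_w `|Z b w - Z t w|%:E))%E.
Proof.
have [_ Z0 _ _] := genZ; set E := (_ + _)%E.
have E0 : (0 <= E)%E by apply: adde_ge0; apply: integral_ge0 => w _; rewrite lee_fin.
rewrite mse_discretized_cell.
(* An infinite [E] makes the bound trivial; otherwise it is a real number [e]. *)
case: (eqVneq E +oo%E) => [->|Eoo]; first by rewrite gt0_muley ?leey// lte_fin.
have Efin : E \is a fin_num by rewrite ge0_fin_numE// ltey.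
pose e := fine E; have Ee : E = e%:E by rewrite fineK.
have e0 : 0 <= e by rewrite -lee_fin -Ee.
pose h (u : R) := ((1 + e) ^+ 2)^-1 * (Num.max 1 u ^+ 2)^-1.
(* As a function of [u] the norm is a partial integral of a jointly measurable nonnegative function,
   so Tonelli gives measurability. *)
have mD : measurable_fun setT (fun u : R => D (1, u)).
  apply/measurable_EFinP.
  rewrite (_ : _ \o _ = fun u =>
    (\int[Q]_w (Num.max (`|1| * Z t w) (`|u| * hatZ w))%:E)%E); last first.
    by apply/funext => u /=; rewrite Dnorm_discretized_cell.2 expectationE.
  apply: (measurable_fun_fubini_tonelli_F (m2 := Q)
    (fun z : measurableTypeR R * T' =>
      (Num.max (`|1| * Z t z.2) (`|z.1| * hatZ z.2))%:E)) => //.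
  - apply/measurable_EFinP; apply: measurable_maxr; apply: measurable_funM => //.
    + exact: measurableT_comp.
    + by apply: measurableT_comp => //; exact: measurableT_comp.
    + exact: measurableT_comp.
  - by move=> z; rewrite lee_fin le_max mulr_ge0// Z0.
have D1 u : 0 < D (1, u) by apply: lt_le_trans (D_ge 1 u); rewrite lt_max normr1 ltr01.
have mh : measurable_fun setT (fun u : R => (Num.max 1 u ^+ 2)^-1).
  apply: measurable_inv_sq => [|u]; last by rewrite lt_max ltr01.
  exact: measurable_maxr.
(* The bound $D(1,u) \le (1+e)\max(1,u)$ makes the integral at least $2/(1+e)^2$; what remains is
   $4(1 - (1+e)^{-2}) \le 8e$. *)
apply: (@le_trans _ _ (2%:E * (2%:E - (((1 + e) ^+ 2)^-1 * 2)%:E))%E).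
  apply: lee_wpmul2l => //; apply: leeB => //.
  rewrite EFinM -(integral_inv_max_sq R) -ge0_integralZl//; last 3 first.
  - by apply/measurable_EFinP; exact: measurable_funTS.
  - by move=> u _; rewrite lee_fin invr_ge0 sqr_ge0.
  - by rewrite lee_fin invr_ge0 sqr_ge0.
  apply: ge0_le_integral => //.
  - by move=> u _; rewrite -EFinM lee_fin mulr_ge0// invr_ge0 sqr_ge0.
  - apply: measurable_funeM; apply/measurable_EFinP; exact: measurable_funTS.
  - apply/measurable_EFinP; apply: measurable_funTS.
    exact: measurable_inv_sq.
  move=> u; rewrite /= in_itv/= andbT => u0.
  rewrite -EFinM lee_fin -invfM -exprMn lef_pV2 ?posrE ?exprn_gt0//.
    have Dle : D (1, u) <= (1 + e) * Num.max 1 u.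
      by apply: Dnorm_discretized_cell_le => //; rewrite -Ee.
    have Dge0 := ltW (D1 u); have mge0 := le_trans Dge0 Dle.
    by rewrite ler_sqr ?nnegrE.
  by rewrite mulr_gt0// ?lt_max ?ltr01// ltr_pwDl.
rewrite Ee -EFinB -!EFinM lee_fin.
have e1 : 0 < 1 + e by rewrite ltr_pwDl.
rewrite -subr_ge0.
have -> : 8 * e - 2 * (2 - ((1 + e) ^+ 2)^-1 * 2) =
    4 * e ^+ 2 * (3 + 2 * e) / (1 + e) ^+ 2.
  by field; rewrite gt_eqF.
by rewrite !mulr_ge0// ?invr_ge0 ?sqr_ge0// addr_ge0// mulr_ge0.
Qed.

End discretized_cell.

(** * Convergence along grids of vanishing diameter *)

Lemma generator_cvg_L1 {R : realType} {d : measure_display}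
    {T : measurableType d} (Q : probability T R) (Z : R -> {RV Q >-> R})
    (a : nat -> R) (t : R) :
  generator Z -> (forall n, a n \in `[0, 1]) -> t \in `[0, 1] ->
  a @ \oo --> t ->
  (\int[Q]_w `|Z (a n) w - Z t w|%:E)%E @[n --> \oo] --> (0 : \bar R)%E.
Proof.
move=> [cZ Z0 [c c1 Zc] _] a01 t01 a_t.
have mZ n : measurable_fun setT (fun w => `|Z (a n) w - Z t w|%:E).
  by apply/measurable_EFinP; apply: measurableT_comp => //; exact: measurable_funB.
have Zcvg : {ae Q, forall w, [set: T] w ->
    `|Z (a n) w - Z t w|%:E @[n --> \oo] --> (cst 0%E w : \bar R)}.
  apply: aeW => w _.
  have Zw : Z (a n) w @[n --> \oo] --> Z t w.
    have /subspace_continuousP/(_ t t01) := cZ w.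
    apply: cvg_comp => U /= [e e0 eU].
    have /cvgrPdist_lt/(_ _ e0) := a_t.
    by apply: filterS => n an; apply: eU => //=; exact: a01.
  apply/fine_cvgP; split; first exact: nearW.
  rewrite -(normr0 R) -(subrr (Z t w)).
  by apply: cvg_norm; apply: cvgB; [exact: Zw|exact: cvg_cst].
have Zdom : {ae Q, forall w n, [set: T] w ->
    (`| `|Z (a n) w - Z t w|%:E| <= cst c%:E w)%E}.
  have Zan : {ae Q, forall w n, Z (a n) w <= c}.
    by apply/ae_foralln => n; exact: Zc.
  apply: filterS2 Zan (Zc _ t01) => w Zac Ztc n _ /=.
  rewrite lee_fin normr_id ler_norml.
  by have := Z0 w _ (a01 n); have := Z0 w _ t01; have := Zac n; lra.
have cint : Q.-integrable [set: T] (cst c%:E) by exact: finite_measure_integrable_cst.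
have [_ _] := dominated_convergence measurableT mZ (measurable_cst 0%E) Zcvg cint Zdom.
by rewrite integral0.
Qed.

Lemma grid_mono {R : realType} (d : nat) (s : nat -> R) :
  is_grid d s -> forall i j, (i <= j <= d)%N -> s i <= s j.
Proof.
move=> [_ _ sS] i; elim=> [|j IH] /andP[ij jd].
  by move: ij; rewrite leqn0 => /eqP->.
move: ij; rewrite leq_eqVlt => /orP[/eqP->//|ij].
by rewrite (le_trans (IH _)) ?ltW ?sS// -ltnS ij ltnW.
Qed.

Lemma grid_itv01 {R : realType} (d : nat) (s : nat -> R) (i : nat) :
  is_grid d s -> (i <= d)%N -> s i \in `[0, 1].
Proof.
move=> g id; have [s0 sd _] := g; rewrite in_itv/= -{1}s0 -sd.
by rewrite !(grid_mono _ _ g)// id/=.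
Qed.

Theorem theorem3p9 (R : realType) (disp : measure_display)
    (T : measurableType disp) (P : probability T R)
    (eta : R -> {RV P >-> R}) (s : nat -> nat -> R) :
  standard_max_stable eta ->
  (forall d, (0 < d)%N -> is_grid d (s d)) ->
  (fun d => diameter d (s d)) @ \oo --> (0 : R) ->
  forall t : R, t \in `[0, 1] ->
  let etahat d := discretized eta d (s d) t in
  let D d := Dnorm P (eta t) (etahat d) in
  let MSE d := ('E_P[fun w => ((eta t w - etahat d w) ^+ 2)%R])%E in
  (forall d, (0 < d)%N ->
    pertains P (eta t) (etahat d) (D d) /\
    MSE d = (2%:E * (2%:E -
      \int[lebesgue_measure]_(u in `[0%R, +oo[) ((D d (1, u) ^+ 2)^-1)%:E))%E) /\
  MSE @ \oo --> 0%E.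
Proof.
move=> [[_ eta0] tail _ [d' [T' [Q [Z [genZ etaZ]]]]]] grid diam0 t t01 etahat D MSE.
pose a d := s d (cell d (s d) t).
pose b d := s d (cell d (s d) t).+1.
(* The width bound puts both ends of the selected cell within the diameter of [t]. *)
have cellE d : (0 < d)%N ->
    [/\ a d \in `[0, 1], b d \in `[0, 1], a d <= t <= b d, a d < b d
      & b d - a d <= diameter d (s d)].
  move=> d0; have g := grid _ d0; have [cd atb] := cellP d0 g t01.
  split => //.
  - by apply: (grid_itv01 _ _ _ g); exact: ltnW.
  - exact: (grid_itv01 _ _ _ g).
  - by case: g => _ _; apply.
  - exact: (le_bigmax 0 (fun i : 'I_d => s d i.+1 - s d i) (Ordinal cd)).
split=> [d d0|].
  have [a01 b01 /andP[a_t t_b] ab _] := cellE _ d0.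
  split.
    exact: (Dnorm_discretized_cell P Q eta Z eta0 tail genZ etaZ
      _ _ _ a01 b01 t01 a_t t_b ab).1.
  rewrite /MSE expectationE.
  exact: (mse_discretized_cell P Q eta Z eta0 tail genZ etaZ
    _ _ _ a01 b01 t01 a_t t_b ab).
(* The grids are only constrained for positive [d], so the limit is taken along the shifted
   sequence. *)
suff : (fun n => MSE n.+1) @ \oo --> (0%E : \bar R) by rewrite (cvg_shiftS MSE).
have to_t (c : nat -> R) : (forall n, `|t - c n.+1| <= diameter n.+1 (s n.+1)) ->
    c n.+1 @[n --> \oo] --> t.
  move=> ct; apply/cvgrPdist_le => e e0.
  have /cvgrPdist_le/(_ _ e0) : diameter n.+1 (s n.+1) @[n --> \oo] --> (0 : R).
    by rewrite (cvg_shiftS (fun d => diameter d (s d))).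
  apply: filterS => n; rewrite sub0r normrN => h.
  exact: le_trans (ct n) (le_trans (ler_norm _) h).
have L1 c : (forall n, c n.+1 \in `[0, 1]) ->
    (forall n, `|t - c n.+1| <= diameter n.+1 (s n.+1)) ->
    (\int[Q]_w `|Z (c n.+1) w - Z t w|%:E)%E @[n --> \oo] --> (0 : \bar R)%E.
  by move=> c01 ct; apply: generator_cvg_L1 => //; exact: to_t.
(* The error lies between 0 and 8 times the $L^1$ increments of [Z] from [t] to the two cell ends,
   both of which tend to 0. *)
apply: (squeeze_cvge (f := cst 0%E) (h := (fun n => 8%:E *
   (\int[Q]_w `|Z (a n.+1) w - Z t w|%:E + \int[Q]_w `|Z (b n.+1) w - Z t w|%:E))%E)).
- apply: nearW => n; have [a01 b01 /andP[a_t t_b] ab _] := cellE _ (ltn0Sn n).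
  rewrite /= /MSE expectationE; apply/andP; split.
    by apply: integral_ge0 => w _; rewrite lee_fin sqr_ge0.
  exact: (mse_discretized_cell_le P Q eta Z eta0 tail genZ etaZ
    _ _ _ a01 b01 t01 a_t t_b ab).
- exact: cvg_cst.
- rewrite -(mule0 8%:E) -[X in (_ * X)%E](adde0 0%E).
  apply: cvgeZl => //; apply: cvgeD => //.
    apply: L1 => n; have [a01 b01 /andP[a_t t_b] ab h] := cellE _ (ltn0Sn n) => //.
    by rewrite ger0_norm ?subr_ge0//; lra.
  apply: L1 => n; have [a01 b01 /andP[a_t t_b] ab h] := cellE _ (ltn0Sn n) => //.
  by rewrite ler0_norm ?subr_le0//; lra.
Qed.
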